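(* Let $\beta,L,\Lambda,K,\Sigma,\Gamma>0$. Let $v:\mathbb{R}\to\mathbb{R}$ be continuous, supported on $[-1,1]$, with $$\int_{-1}^1 v(t)\,dt=0,\qquad \int_{-1}^1\Bigl(-\frac{t^2}{2}\Bigr)v(t)\,dt=1,\qquad v(t)=O(|t|^{\beta})\ \text{ as } t\to0,$$ and put $v^h(t)=h^3v(ht)$. Let $h=h_n=(\eta\log n)^{-1/2}$ with $0<\eta<\Sigma^{-2}$, and let $M_n=m_nh_n^{-2}$ be positive numbers, where $(m_n)$ is a sequence of real numbers diverging to $+\infty$ at a slower rate than $\log n$ (i.e. $m_n=o(\log n)$). Define the estimator $$\tilde\sigma_n^2=\int_{-1/h}^{1/h}\max\{\min\{M_n,\log(|\phi_{emp}(t)|)\},-M_n\}\,v^h(t)\,dt .$$ Then there exist a constant $A>0$ and an integer $n_0$ such that for all $n\ge n_0$ $$\sup_{|\gamma|\le\Gamma}\ \sup_{\sigma\in(0,\Sigma]}\ \sup_{\rho\in W(\beta,L,\Lambda,K)}\operatorname{E}\bigl[(\tilde\sigma_n^2-\sigma^2)^2\bigr]\le A(\log n)^{-\beta-3}.$$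
   Context: For $\gamma\in\mathbb{R}$, $\sigma\ge0$ and a Lévy density $\rho:\mathbb{R}\to[0,\infty)$ with $0<\lambda:=\int_{-\infty}^{\infty}\rho(x)\,dx<\infty$, let $X_1,\dots,X_n$ be i.i.d. copies of a random variable $X$ with characteristic function $$\phi_X(t)=\exp\Bigl[i\gamma t-\tfrac12\sigma^2t^2+\int_{\mathbb{R}}(e^{itx}-1)\rho(x)\,dx\Bigr].$$ Expectations are taken under the law determined by $(\gamma,\sigma^2,\rho)$. Write $f=\rho/\lambda$ (a probability density), $\phi_f(t)=\int e^{itx}f(x)\,dx$, and $\phi_{emp}(t)=\frac1n\sum_{j=1}^n e^{itX_j}$ for the empirical characteristic function. Define $$W(\beta,L,\Lambda,K)=\Bigl\{\rho:\ \rho=\lambda f,\ f\text{ a probability density},\ \int_{-\infty}^{\infty}x^2f(x)\,dx\le K,\ \int_{-\infty}^{\infty}|t|^\beta|\phi_f(t)|\,dt\le L,\ \lambda\in(0,\Lambda]\Bigr\}.$$ Convention: $\log 0=-\infty$, so that the truncated expression equals $-M_n$ where $\phi_{emp}(t)=0$. The constants $A,n_0$ do not depend on $n$ or on $(\gamma,\sigma,\rho)$ in the indicated classes (they may depend on the class parameters, $\eta$, $(m_n)$ and $v$). *)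

(* Defs.v *)
From HB Require Import structures.
From mathcomp Require Import all_boot all_order all_algebra.
From mathcomp Require Import all_classical all_reals all_analysis.
From mathcomp Require Import complex.

Set Implicit Arguments.
Unset Strict Implicit.
Unset Printing Implicit Defensive.

Import Order.TTheory GRing.Theory Num.Theory.
Import numFieldNormedType.Exports.

Local Open Scope classical_set_scope.
Local Open Scope ring_scope.
Local Open Scope complex_scope.

Section ComplexPreliminaries.
Context {R : realType}.

Definition cexp (z : R[i]) : R[i] :=
  (expR (complex.Re z) * cos (complex.Im z))
    +i* (expR (complex.Re z) * sin (complex.Im z)).

Definition cmod (z : R[i]) : R := ComplexField.Normc.normc z.

(* Both components are [fine]d integrals: this is the usual complex integral
   as soon as [g] is integrable, which is the case for every use below. *)
Definition cintegral d (T : measurableType d) (mu : {measure set T -> \bar R})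
    (g : T -> R[i]) : R[i] :=
  (\int[mu]_x complex.Re (g x)) +i* (\int[mu]_x complex.Im (g x)).

End ComplexPreliminaries.

Section CharacteristicFunctions.
Context {R : realType}.

Definition charfun_RV d (T : measurableType d) (P : probability T R)
    (X : T -> R) (t : R) : R[i] :=
  cintegral P (fun w => cexp ((t * X w) *i)).

Definition charfun_density (f : R -> R) (t : R) : R[i] :=
  cintegral lebesgue_measure (fun x => cexp ((t * x) *i) * (f x)%:C).

Definition charfun_Levy (gamma sigma : R) (rho : R -> R) (t : R) : R[i] :=
  cexp ((gamma * t) *i - (2^-1 * sigma ^+ 2 * t ^+ 2)%:C
    + cintegral lebesgue_measure
        (fun x => (cexp ((t * x) *i) - 1) * (rho x)%:C)).

Definition charfun_emp (n : nat) (x : 'I_n -> R) (t : R) : R[i] :=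
  (n%:R^-1)%:C * \sum_(j < n) cexp ((t * x j) *i).

End CharacteristicFunctions.

Section Model.
Context {R : realType}.

Definition probability_density (f : R -> R) : Prop :=
  [/\ measurable_fun setT f,
      forall x, 0 <= f x &
      (\int[lebesgue_measure]_x (f x)%:E = 1)%E].

Definition class_W (beta L Lambda K : R) : set (R -> R) :=
  [set rho | exists (lambda : R) (f : R -> R),
    [/\ rho = (fun x => lambda * f x),
        probability_density f,
        (\int[lebesgue_measure]_x (x ^+ 2 * f x)%:E <= K%:E)%E,
        (\int[lebesgue_measure]_t
           (`|t| `^ beta * cmod (charfun_density f t))%:E <= L%:E)%E &
        0 < lambda <= Lambda]].

Definition mutually_independent d (T : measurableType d)
    (P : probability T R) (n : nat) (X : 'I_n -> {RV P >-> R}) : Prop :=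
  forall (J : {set 'I_n}) (B : 'I_n -> set R),
    (forall i, measurable (B i)) ->
    (P (\bigcap_(i in [set` J]) (X i @^-1` B i))
       = \prod_(i in J) P (X i @^-1` B i))%E.

Definition identically_distributed d (T : measurableType d)
    (P : probability T R) (n : nat) (X : 'I_n -> {RV P >-> R}) : Prop :=
  forall (i j : 'I_n) (B : set R),
    measurable B -> distribution P (X i) B = distribution P (X j) B.

Definition iid_Levy_sample d (T : measurableType d) (P : probability T R)
    (n : nat) (X : 'I_n -> {RV P >-> R})
    (gamma sigma : R) (rho : R -> R) : Prop :=
  [/\ mutually_independent X,
      identically_distributed X &
      forall i t, charfun_RV P (X i) t = charfun_Levy gamma sigma rho t].

End Model.

Section Estimator.
Context {R : realType}.

Definition kernel_class (beta : R) (v : R -> R) : Prop :=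
  [/\ continuous v,
      (forall t, 1 < `|t| -> v t = 0),
      \int[lebesgue_measure]_(t in `[-1, 1]) v t = 0,
      \int[lebesgue_measure]_(t in `[-1, 1]) (- (t ^+ 2 / 2) * v t) = 1 &
      v =O_ (0^') (fun t : R => `|t| `^ beta)].

(* [bandwidth], [truncation] are meaningful for n >= 2 only. *)
Definition bandwidth (eta : R) (n : nat) : R :=
  (eta * ln n%:R) `^ (- 2^-1).

Definition truncation (eta : R) (m : nat -> R) (n : nat) : R :=
  m n * bandwidth eta n ^- 2.

Definition scaled_kernel (h : R) (v : R -> R) (t : R) : R :=
  h ^+ 3 * v (h * t).

(* [lne 0 = -oo], so this is [- M] when [phi = 0]. *)
Definition truncated_log (M : R) (phi : R[i]) : R :=
  fine (maxe (mine M%:E (lne (cmod phi)%:E)) (- M)%:E).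

Definition sigma2_tilde (v : R -> R) (eta : R) (m : nat -> R)
    (n : nat) (x : 'I_n -> R) : R :=
  let h := bandwidth eta n in
  \int[lebesgue_measure]_(t in `[- h^-1, h^-1])
    (truncated_log (truncation eta m n) (charfun_emp x t)
       * scaled_kernel h v t).

End Estimator.

(* Main.v *)
Require Import Defs.
From HB Require Import structures.
From mathcomp Require Import all_boot all_order all_algebra.
From mathcomp Require Import all_classical all_reals all_analysis.
From mathcomp Require Import measurable_realfun complex ring lra.

Set Implicit Arguments.
Unset Strict Implicit.
Unset Printing Implicit Defensive.

Import Order.TTheory GRing.Theory Num.Theory.
Import numFieldNormedType.Exports.

Local Open Scope classical_set_scope.
Local Open Scope ring_scope.

(** Since log |phi_X(t)| = - sigma^2 t^2 / 2 + lambda (Re phi_f(t) - 1), the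
    moment conditions on v reduce the integral of log |phi_X| v^h to sigma^2 plus
    a bias lambda int Re(phi_f) v^h, which is O(h^(beta+3)) because
    |v(t)| <= C |t|^beta.  For the stochastic part, on |t| <= 1/h the truncation
    gives |log-truncated(phi_emp) - log |phi_X|| <= (2 + 4 M) |phi_emp - phi_X| /
    |phi_X|, while E |phi_emp - phi_X|^2 <= 8 / n and |phi_X|^-2 is at most a
    constant times n^(Sigma^2 eta) with Sigma^2 eta < 1; so this part is a power of
    log n times a negative power of n. *)

(** The obstacle is the singularity of the logarithm at 0. No event on which phi_emp is close to
    phi_X is isolated, and no concentration inequality is used: the bound by the relative error
    |phi_emp - phi_X| / |phi_X| holds for every outcome, so second moments suffice. The price is the
    factor M_n, at most eta (log n)^2 for large n, which a negative power of n absorbs. The bound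
    requires the truncation to be inactive at phi_X, that is |log |phi_X|| <= M_n on |t| <= 1/h; the
    divergence of m_n ensures this for large n, and m_n = o(log n) keeps M_n polylogarithmic.
    Cauchy-Schwarz in t then brings in the integral of |phi_emp - phi_X|^2, whose expectation is
    bounded by Tonelli's theorem. Measurability in the outcome is proved for this dominating
    quantity; the estimator itself enters only through monotonicity of the integral. The final rate
    is that of the squared bias, since h^(2 (beta + 3)) = (eta log n)^(- beta - 3). *)

Section IntegralGeneralities.
Context d (T : measurableType d) (R : realType) (mu : {measure set T -> \bar R}).

(* Bounds the risk without measurability of the estimator in the sample. *)
Lemma ge0_le_integral_unmeasurable (f g : T -> \bar R) :
  (forall x, 0 <= f x)%E -> (forall x, f x <= g x)%E ->
  (\int[mu]_x f x <= \int[mu]_x g x)%E.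
Proof.
move=> f0 fg; have g0 x : (0 <= g x)%E := le_trans (f0 x) (fg x).
rewrite !ge0_integralTE//; apply: le_ereal_sup => _ [h /= hf <-].
by exists h => //= x; exact: le_trans (hf x) (fg x).
Qed.

Lemma bounded_fun_integrable (D : set T) (f : T -> R) (M : R) :
  measurable D -> (mu D < +oo)%E -> measurable_fun D f ->
  (forall x, D x -> `|f x| <= M) -> mu.-integrable D (EFin \o f).
Proof.
move=> mD Dfin mf fM; apply: measurable_bounded_integrable => //.
by exists M; split; [exact: num_real | move=> x Mx y Dy; exact: le_trans (fM y Dy) (ltW Mx)].
Qed.

(** Cauchy-Schwarz against the constant 1, obtained from the nonnegativity of the second moment of
    [f] about its mean. *)
Lemma sqr_Rintegral_le (D : set T) (f : T -> R) (M : R) :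
  measurable D -> (mu D < +oo)%E -> measurable_fun D f ->
  (forall x, D x -> `|f x| <= M) ->
  (\int[mu]_(x in D) f x) ^+ 2
    <= fine (mu D) * \int[mu]_(x in D) (f x ^+ 2).
Proof.
move=> mD Dfin mf fM.
have intf := bounded_fun_integrable mD Dfin mf fM.
have mf2 : measurable_fun D (fun x => f x ^+ 2) by exact: measurable_funX.
have f2M x : D x -> `|f x ^+ 2| <= M ^+ 2.
  move=> Dx; rewrite normrX lerXn2r ?nnegrE//; last exact: fM.
  exact: le_trans (fM x Dx).
have intf2 := bounded_fun_integrable mD Dfin mf2 f2M.
set I := \int[mu]_(x in D) f x; set J := \int[mu]_(x in D) (f x ^+ 2).
set m := fine (mu D).
have m0 : 0 <= m by rewrite fine_ge0.
(* The integral of (f - c)^2, to be taken at the mean c = I / m. *)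
have key (c : R) : 0 <= J + (- (2 * c) * I + c ^+ 2 * m).
  have -> : J + (- (2 * c) * I + c ^+ 2 * m) =
      \int[mu]_(x in D) (f x ^+ 2 + (- (2 * c) * f x + c ^+ 2)).
    have i1 : mu.-integrable D (EFin \o (fun x => - (2 * c) * f x)).
      exact: (integrableZl mD (- (2 * c)) intf).
    have i2 : mu.-integrable D (EFin \o (fun=> c ^+ 2)).
      apply: (@bounded_fun_integrable _ _ `|c ^+ 2|) => //.
    have i3 : mu.-integrable D (EFin \o (fun x => - (2 * c) * f x + c ^+ 2)).
      exact: (integrableD mD i1 i2).
    by rewrite RintegralD// RintegralD// RintegralZl// Rintegral_cst.
  apply: Rintegral_ge0 => x _.
  have -> : f x ^+ 2 + (- (2 * c) * f x + c ^+ 2) = (f x - c) ^+ 2 by ring.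
  exact: sqr_ge0.
(* If [D] has measure zero, [key] is affine in [c] with slope -2 I. The chosen [c] would give it the
   value -1 if [I] were nonzero. *)
have [m_eq0|mn0] := eqVneq m 0.
  have [->|I0] := eqVneq I 0; first by rewrite m_eq0 mul0r expr0n.
  have := key ((J + 1) / (2 * I)).
  have -> : J + (- (2 * ((J + 1) / (2 * I))) * I + ((J + 1) / (2 * I)) ^+ 2 * m) = - 1.
    by rewrite m_eq0; field.
  by rewrite oppr_ge0 ler10.
have mp : 0 < m by rewrite lt_neqAle eq_sym mn0.
have := key (I / m).
have -> : J + (- (2 * (I / m)) * I + (I / m) ^+ 2 * m) = (m * J - I ^+ 2) / m.
  by field.
by rewrite pmulr_lge0 ?invr_gt0// subr_ge0.
Qed.
End IntegralGeneralities.

(** * Variance of an empirical mean under pairwise independence *)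

Section PairwiseIndependence.
Context d (T : measurableType d) (R : realType) (P : probability T R).

Lemma bounded_fun_integrableT d' (T' : measurableType d') (Q : probability T' R)
    (h : T' -> R) :
  measurable_fun setT h -> (exists N : R, forall x, `|h x| <= N) ->
  Q.-integrable setT (EFin \o h).
Proof.
move=> mh [N hN]; apply: (@bounded_fun_integrable _ _ _ _ _ _ N) => //.
by apply: le_lt_trans (probability_le1 Q measurableT) _; rewrite ltry.
Qed.

Lemma Rintegral_cst_probability (c : R) : \int[P]_(w in [set: T]) c = c.
Proof.
have PT : (P : {measure set T -> \bar R}) setT = 1%E := probability_setT P.
by rewrite Rintegral_cst// PT mulr1.
Qed.

(** Factorization on rectangles identifies the joint law with the product of the marginals, and
    Fubini's theorem then splits the integral of the bounded function g(x) g(y). *)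
Lemma independent_Rintegral_prod (X Y : {RV P >-> R}) (g : R -> R) (M : R) :
  measurable_fun setT g -> (forall x, `|g x| <= M) ->
  (forall A B, measurable A -> measurable B ->
    (P ((X @^-1` A) `&` (Y @^-1` B)) = P (X @^-1` A) * P (Y @^-1` B))%E) ->
  \int[P]_w (g (X w) * g (Y w)) =
  (\int[P]_w g (X w)) * (\int[P]_w g (Y w)).
Proof.
move=> mg gM indep.
have fin := bounded_fun_integrableT.
have mXY : measurable_fun setT (fun w => (X w, Y w)).
  by apply: measurable_fun_pair; exact: measurable_funP.
pose XY : {RV P >-> (R * R)%type} :=
  HB.pack (fun w => (X w, Y w)) (isMeasurableFun.Build _ _ _ _ _ mXY).
have XYE C : measurable C ->
    (distribution P X \x distribution P Y)%E C = distribution P XY C.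
  exact: product_measure_unique.
pose f (z : R * R) := g z.1 * g z.2.
have mf : measurable_fun setT f by apply/measurable_funM; apply: measurableT_comp.
have bf : exists N, forall z, `|f z| <= N.
  by exists (M * M) => z; rewrite normrM ler_pM.
have intX (Z : {RV P >-> R}) : \int[P]_w g (Z w) = \int[distribution P Z]_x g x.
  rewrite /Rintegral integral_distribution//; first exact/measurable_EFinP.
  by apply: fin; [exact: measurableT_comp | exists M].
rewrite {1}/Rintegral.
have -> : (\int[P]_w (g (X w) * g (Y w))%:E = \int[distribution P XY]_z (f z)%:E)%E.
  rewrite integral_distribution//; first exact/measurable_EFinP.
  apply: fin; first exact: (measurableT_comp mf mXY).
  by case: bf => N fN; exists N.
rewrite (eq_measure_integral (distribution P X \x distribution P Y)%E); last first.
  by move=> C mC _; exact: esym (XYE C mC).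
rewrite -integral12_prod_meas1; last exact: fin.
rewrite /fubini_F/=.
transitivity (fine (\int[distribution P X]_x (g x * \int[distribution P Y]_y g y)%:E)).
  congr fine; apply: eq_integral => x _.
  rewrite /f/= -RintegralZl//; last by apply: fin => //; exists M.
  rewrite /Rintegral fineK//.
  apply: integrable_fin_num => //; apply: fin; first exact: measurable_funM.
  by exists (`|g x| * M) => y; rewrite normrM ler_wpM2l.
rewrite -/(Rintegral _ _ _) RintegralZr ?intX//.
by apply: fin => //; exists M.
Qed.

(** After centring, the off-diagonal terms of the expanded square have mean zero, so n of the n^2
    terms remain. Each is at most (2 M)^2, because |g - c| <= 2 M. *)
Lemma Rintegral_sqr_mean_le (n : nat) (X : 'I_n -> {RV P >-> R}) (g : R -> R)
    (M c : R) :
  (0 < n)%N -> measurable_fun setT g -> (forall x, `|g x| <= M) ->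
  (forall i j, i != j -> forall A B, measurable A -> measurable B ->
    (P ((X i @^-1` A) `&` (X j @^-1` B)) = P (X i @^-1` A) * P (X j @^-1` B))%E) ->
  (forall i, \int[P]_w g (X i w) = c) ->
  \int[P]_w ((n%:R^-1 * (\sum_(j < n) g (X j w)) - c) ^+ 2) <= (2 * M) ^+ 2 / n%:R.
Proof.
move=> n0 mg gM indep Egc.
have n0R : 0 < n%:R :> R by rewrite ltr0n.
have fin := (fun h => @bounded_fun_integrableT _ _ P h).
have fing i : P.-integrable setT (EFin \o (fun w => g (X i w))).
  by apply: fin; [exact: measurableT_comp | exists M].
(* As n > 0, [c] is the mean of an actual variable of the sample. *)
have cM : `|c| <= M.
  rewrite -(Egc (Ordinal n0)); apply: le_trans (le_normr_Rintegral _ _) _ => //.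
  have -> : M = \int[P]_(w in setT) M.
    by rewrite Rintegral_cst_probability.
  apply: le_Rintegral => //.
  - apply: fin; last by exists M => x; rewrite normr_id.
    by do 2 apply: measurableT_comp => //.
  - by apply: fin => //; exists `|M|.
pose g' x := g x - c.
have mg' : measurable_fun setT g' by exact: measurable_funB.
have g'M x : `|g' x| <= 2 * M.
  by rewrite (le_trans (ler_normB _ _))// mulr2n mulrDl !mul1r lerD.
have Eg' i : \int[P]_w g' (X i w) = 0.
  rewrite RintegralB//; last by apply: fin => //; exists `|c|.
  by rewrite Egc Rintegral_cst_probability subrr.
have fing' i : P.-integrable setT (EFin \o (fun w => g' (X i w))).
  by apply: fin; [exact: measurableT_comp | exists (2 * M)].
have fingg i j : P.-integrable setT (EFin \o (fun w => g' (X i w) * g' (X j w))).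
  apply: fin; first by apply: measurable_funM; exact: measurableT_comp.
  by exists (2 * M * (2 * M)) => x; rewrite normrM ler_pM.
have sumE (I : Type) (s : seq I) (F : I -> T -> R) :
    (forall i, P.-integrable setT (EFin \o F i)) ->
    P.-integrable setT (EFin \o (fun w => \sum_(i <- s) F i w)) /\
    \int[P]_w (\sum_(i <- s) F i w) = \sum_(i <- s) \int[P]_w F i w.
  move=> iF; elim: s => [|i s [IH1 IH2]].
    rewrite big_nil; have -> : (fun w => \sum_(i <- [::]) F i w) = cst 0.
      by apply/funext => w; rewrite big_nil.
    by rewrite Rintegral_cst_probability; split => //; apply: fin => //; exists 0 => x; rewrite normr0.
  have -> : (fun w => \sum_(j <- i :: s) F j w) = (fun w => F i w + \sum_(j <- s) F j w).
    by apply/funext => w; rewrite big_cons.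
  rewrite big_cons RintegralD// IH2; split => //.
  exact: (integrableD measurableT (iF i) IH1).
have -> : \int[P]_w ((n%:R^-1 * (\sum_(j < n) g (X j w)) - c) ^+ 2) =
    \int[P]_w (n%:R^-1 ^+ 2 * \sum_(i < n) \sum_(j < n) (g' (X i w) * g' (X j w))).
  apply: eq_Rintegral => w _.
  rewrite -big_distrlr/= -expr2 -exprMn; congr (_ ^+ 2).
  rewrite /g' sumrB sumr_const card_ord mulrBr; congr (_ - _).
  by rewrite -[c *+ n]mulr_natl mulrA mulVf ?gt_eqF// mul1r.
have [i1 i1E] := sumE _ (index_enum 'I_n) (fun i w => \sum_(j < n) (g' (X i w) * g' (X j w)))
  (fun i => (sumE _ _ _ (fingg i)).1).
rewrite RintegralZl// i1E.
apply: (@le_trans _ _ (n%:R^-1 ^+ 2 * \sum_(i < n) (2 * M) ^+ 2)); last first.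
  rewrite sumr_const card_ord -[_ ^+ 2 *+ n]mulr_natl.
  suff -> : n%:R^-1 ^+ 2 * (n%:R * (2 * M) ^+ 2) = (2 * M) ^+ 2 / n%:R by [].
  by field; rewrite gt_eqF.
rewrite ler_wpM2l ?sqr_ge0//; apply: ler_sum => i _.
rewrite (sumE _ _ _ (fingg i)).2 (bigD1 i)//= big1 ?addr0; last first.
  move=> j ji; rewrite (@independent_Rintegral_prod _ _ _ (2 * M))// ?Eg' ?mul0r//.
  by apply: indep; rewrite eq_sym.
have -> : (2 * M) ^+ 2 = \int[P]_(w in setT) ((2 * M) ^+ 2).
  by rewrite Rintegral_cst_probability.
apply: le_Rintegral => //; first by apply: fin => //; exists `|(2 * M) ^+ 2|.
move=> w _; rewrite -expr2 -real_normK ?num_real// lerXn2r ?nnegrE//.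
exact: le_trans (g'M (X i w)).
Qed.

End PairwiseIndependence.

(** * Stability of the truncated logarithm of a modulus *)

Section TruncatedLog.
Context {R : realType}.

Lemma cmodE (x y : R) : cmod (Complex x y) = Num.sqrt (x ^+ 2 + y ^+ 2).
Proof. by []. Qed.

Lemma cmod_ge0 (z : R[i]) : 0 <= cmod z.
Proof. by case: z => x y; rewrite cmodE sqrtr_ge0. Qed.

Lemma cmod_cexp (z : R[i]) : cmod (cexp z) = expR (complex.Re z).
Proof.
rewrite /cexp cmodE !exprMn -mulrDr cos2Dsin2 mulr1 sqrtr_sqr.
by rewrite ger0_norm ?expR_ge0.
Qed.

Lemma normr_Re_le_cmod (z : R[i]) : `|complex.Re z| <= cmod z.
Proof. by case: z => x y; rewrite cmodE -sqrtr_sqr ler_wsqrtr// lerDl sqr_ge0. Qed.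

Lemma cmod_distl (z w : R[i]) : `|cmod z - cmod w| <= cmod (z - w).
Proof.
have tri (a b : R[i]) : cmod a <= cmod (a - b) + cmod b.
  by rewrite -{1}(subrK b a); exact: complex.le_normcD.
rewrite ler_norml lerBlDr tri andbT lerNl opprB lerBlDr.
have -> : cmod (z - w) = cmod (w - z).
  by rewrite -opprB; exact: complex.normcN.
exact: tri.
Qed.

Definition clamp (M x : R) := Num.max (Num.min M x) (- M).

Lemma truncated_logE (M : R) (z : R[i]) : - M <= M ->
  truncated_log M z = if cmod z <= 0 then - M else clamp M (ln (cmod z)).
Proof.
move=> MM; rewrite /truncated_log /lne; case: ifPn => _.
  by rewrite (min_idPr (leNye _)) (max_idPr (leNye _)).
by rewrite /clamp -EFin_min -EFin_max.
Qed.

Lemma clamp_bounded (M x : R) : 0 <= M -> `|clamp M x| <= M.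
Proof.
move=> M0; rewrite ler_norml /clamp le_max lexx orbT/= ge_max ge_min lexx/=.
lra.
Qed.

Lemma clamp_id (M x : R) : `|x| <= M -> clamp M x = x.
Proof.
by rewrite ler_norml /clamp => /andP[h1 h2]; rewrite (min_idPr h2) (max_idPl h1).
Qed.

Lemma clamp_lipschitz (M x y : R) : `|clamp M x - clamp M y| <= `|x - y|.
Proof.
rewrite /clamp.
have minl a b c : `|Num.min c a - Num.min c b| <= `|a - b| :> R.
  rewrite ler_norml; have [h1 h2] : a - b <= `|a - b| /\ - (a - b) <= `|a - b|.
    by rewrite ler_norm -normrN ler_norm.
  have h3 := normr_ge0 (a - b).
  by rewrite !minEle; do 2 case: ifPn => ?; apply/andP; split; lra.
apply: le_trans (minl x y M).
rewrite ler_norml; set a := Num.min M x; set b := Num.min M y.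
have [h1 h2] : a - b <= `|a - b| /\ - (a - b) <= `|a - b|.
  by rewrite ler_norm -normrN ler_norm.
have h3 := normr_ge0 (a - b).
by rewrite !maxEle; do 2 case: ifPn => ?; apply/andP; split; lra.
Qed.

Lemma measurable_truncated_log d (T : measurableType d) (M : R) (f g : T -> R) :
  0 <= M -> measurable_fun setT f -> measurable_fun setT g ->
  measurable_fun setT (fun t => truncated_log M (Complex (f t) (g t))).
Proof.
move=> M0 mf mg.
have mq : measurable_fun setT (fun t => cmod (Complex (f t) (g t))).
  have -> : (fun t => cmod (Complex (f t) (g t))) =
      Num.sqrt \o (fun t => f t ^+ 2 + g t ^+ 2) by [].
  apply: measurableT_comp; last by apply: measurable_funD; exact: measurable_funX.
  exact: continuous_measurable_fun (@sqrt_continuous R).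
have -> : (fun t => truncated_log M (Complex (f t) (g t))) =
    fun t => if cmod (Complex (f t) (g t)) <= 0 then - M
             else clamp M (ln (cmod (Complex (f t) (g t)))).
  by apply/funext => t; rewrite truncated_logE//; lra.
apply: measurable_fun_ifT => //; first exact: measurable_fun_ler.
apply: measurable_maxr => //; apply: measurable_minr => //.
exact: measurableT_comp.
Qed.

Lemma truncated_log_bounded (M : R) (z : R[i]) : 0 <= M ->
  `|truncated_log M z| <= M.
Proof.
move=> M0; rewrite truncated_logE; last lra.
by case: ifPn => _; [rewrite normrN ger0_norm | exact: clamp_bounded].
Qed.

(* When |z| is far from |w| the truncation still bounds the difference by 2 M,
   which the relative error then dominates. *)
Lemma truncated_log_dist (M : R) (z w : R[i]) :
  0 < cmod w -> `|ln (cmod w)| <= M ->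
  `|truncated_log M z - ln (cmod w)| <= (2 + 4 * M) * (cmod (z - w) / cmod w).
Proof.
set p := cmod w => p0 lnp.
have M0 : 0 <= M by exact: le_trans lnp.
have dist : `|cmod z - p| <= cmod (z - w) := cmod_distl z w.
set D := cmod (z - w) in dist *; have D0 : 0 <= D := cmod_ge0 _.
have Dp0 : 0 <= D / p by rewrite divr_ge0// ltW.
have [near|far] := leP D (p / 2); last first.
  have : 1 <= 2 * (D / p) by rewrite mulrA ler_pdivlMr// mul1r; lra.
  move=> h; apply: le_trans (ler_normB _ _) _.
  apply: le_trans (lerD (truncated_log_bounded z M0) lnp) _.
  by have := ler_wpM2l M0 h; nra.
(* In the near case both moduli are at least p / 2, so ln a - ln b <= (a - b) / b gives at most 2 D
   / p in either direction: this is the summand 2 of the constant. *)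
have q0 : p / 2 <= cmod z.
  by move: dist; rewrite ler_norml => /andP[? _]; lra.
have qp : 0 < cmod z by rewrite (lt_le_trans _ q0)// divr_gt0.
rewrite truncated_logE; last lra.
(* The truncation is inactive at [w], so [ln (cmod w)] equals its own clamp, and the Lipschitz bound
   removes both clamps at once. *)
rewrite [cmod z <= 0]leNgt qp/= -(clamp_id lnp); apply: le_trans (clamp_lipschitz _ _ _) _.
have ln_le (a b : R) : 0 < a -> 0 < b -> ln a - ln b <= (a - b) / b.
  move=> a0 b0; rewrite -ln_div ?posrE//.
  have -> : (a - b) / b = a / b - 1 by field; rewrite gt_eqF.
  rewrite lerBrDl; apply: le_trans (expR_ge1Dx _) _.
  by rewrite lnK// posrE divr_gt0.
apply: (@le_trans _ _ (2 * (D / p))); last by rewrite ler_wpM2r//; lra.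
rewrite ler_norml; move: dist; rewrite ler_norml => /andP[d1 d2]; apply/andP; split.
  have := ln_le _ _ p0 qp; set l := ln _; set l' := ln _.
  suff : (p - cmod z) / cmod z <= 2 * (D / p) by lra.
  apply: (@le_trans _ _ (D / cmod z)); first by rewrite ler_pM2r ?invr_gt0//; lra.
  rewrite mulrCA ler_wpM2l// -[X in _ <= X]invrK lef_pV2 ?posrE ?invr_gt0 ?divr_gt0//.
  by rewrite invf_div.
apply: le_trans (ln_le _ _ qp p0) _.
apply: (@le_trans _ _ (D / p)); first by rewrite ler_pM2r ?invr_gt0.
lra.
Qed.

End TruncatedLog.

(** * Modulus and measurability of the characteristic functions *)

Section CharacteristicFunctionModulus.
Context {R : realType}.
Local Notation leb := (@lebesgue_measure R).

(** The drift and the sine part of the jump integral contribute only a phase. *)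
Lemma cmod_charfun_Levy (gamma sigma : R) (rho : R -> R) (t : R) :
  cmod (charfun_Levy gamma sigma rho t) =
  expR (- (sigma ^+ 2 * t ^+ 2 / 2) + \int[leb]_x ((cos (t * x) - 1) * rho x)).
Proof.
rewrite /charfun_Levy cmod_cexp /cintegral /=; congr expR.
congr (_ + _); first by field.
by apply: eq_Rintegral => x _; rewrite expR0; ring.
Qed.

Definition charfun_density_Re (f : R -> R) (t : R) : R :=
  \int[leb]_x (cos (t * x) * f x).

Lemma Re_charfun_density (f : R -> R) (t : R) :
  complex.Re (charfun_density f t) = charfun_density_Re f t.
Proof. by apply: eq_Rintegral => x _ /=; rewrite expR0; ring. Qed.

(** Serves two measures: Lebesgue measure with weight f for the characteristic function of the
    density, and [P] with weight 1 for that of an observation. *)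
Lemma measurable_bounded_param_Rintegral d (T : measurableType d)
    (mu : {sigma_finite_measure set T -> \bar R}) (u : R * T -> R) (w : T -> R) :
  measurable_fun setT u -> (forall z, `|u z| <= 1) ->
  (forall x, 0 <= w x) -> mu.-integrable setT (EFin \o w) ->
  measurable_fun setT (fun t => \int[mu]_x (u (t, x) * w x)).
Proof.
move=> mu1 u1 w0 iw.
have mw : measurable_fun setT w by apply/measurable_EFinP; exact: measurable_int iw.
have iuw t : mu.-integrable setT (EFin \o (fun x => u (t, x) * w x)).
  apply: (le_integrable _ _ _ iw) => //=.
    apply/measurable_EFinP/measurable_funM => //.
    exact: (measurable_fun_pair2 _ mu1).
  move=> x _; rewrite lee_fin normrM ler_piMl//.
(* Tonelli's theorem needs the nonnegative integrand (1 + u) w. *)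
have -> : (fun t => \int[mu]_x (u (t, x) * w x)) =
    fun t => fine (\int[mu]_x (((1 + u (t, x)) * w x)%:E))%E - \int[mu]_x w x.
  apply/funext => t; rewrite -/(Rintegral _ _ _).
  under [X in _ = X - _]eq_Rintegral do rewrite mulrDl mul1r.
  by rewrite RintegralD// addrC addKr.
apply: measurable_funB => //; apply: measurableT_comp => //.
pose v (z : R * T) := ((1 + u z) * w z.2)%:E.
apply: (measurable_fun_fubini_tonelli_F v) => //.
  apply/measurable_EFinP/measurable_funM; first exact: measurable_funD.
  exact: measurableT_comp.
move=> z; rewrite lee_fin mulr_ge0//.
by have := u1 z; rewrite ler_norml => /andP[? _]; lra.
Qed.

Section Density.
Variables (f : R -> R) (hf : probability_density f).

Lemma integrable_density : leb.-integrable setT (EFin \o f).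
Proof.
case: hf => mf f0 f1; apply/integrableP; split; first exact/measurable_EFinP.
under eq_integral => x _ do rewrite /= ger0_norm//.
by rewrite f1 ltry.
Qed.

Lemma measurable_cos_mul : measurable_fun setT (fun z : R * R => cos (z.1 * z.2)).
Proof.
apply: measurableT_comp; last exact: measurable_funM.
exact: continuous_measurable_fun (@continuous_cos R).
Qed.

Lemma integrable_cos_density (t : R) :
  leb.-integrable setT (EFin \o (fun x => cos (t * x) * f x)).
Proof.
case: (hf) => mf f0 f1; apply: (le_integrable _ _ _ integrable_density) => //=.
  apply/measurable_EFinP/measurable_funM => //.
  exact: (measurable_fun_pair2 t measurable_cos_mul).
by move=> x _; rewrite lee_fin normrM ler_piMl// ler_norml cos_geN1 cos_le1.
Qed.

Lemma Rintegral_density : \int[leb]_x f x = 1.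
Proof. by case: hf => _ _ f1; rewrite /Rintegral f1. Qed.

Lemma charfun_density_Re_bounded (t : R) : `|charfun_density_Re f t| <= 1.
Proof.
case: (hf) => mf f0 f1; rewrite -Rintegral_density.
apply: le_trans (le_normr_Rintegral _ (integrable_cos_density t)) _ => //.
apply: le_Rintegral => //; [|exact: integrable_density|].
  exact: integrable_norm (integrable_cos_density t).
by move=> x _; rewrite normrM [`|f x|]ger0_norm// ler_piMl// ler_norml cos_geN1 cos_le1.
Qed.

Lemma measurable_charfun_density_Re : measurable_fun setT (charfun_density_Re f).
Proof.
case: (hf) => mf f0 f1.
apply: (@measurable_bounded_param_Rintegral _ _ leb (fun z => cos (z.1 * z.2)) f) => //.
- exact: measurable_cos_mul.
- by move=> z; rewrite ler_norml cos_geN1 cos_le1.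
- exact: integrable_density.
Qed.

Lemma cmod_charfun_Levy_density (gamma sigma lambda : R) (t : R) :
  cmod (charfun_Levy gamma sigma (fun x => lambda * f x) t) =
  expR (- (sigma ^+ 2 * t ^+ 2 / 2) + lambda * (charfun_density_Re f t - 1)).
Proof.
rewrite cmod_charfun_Levy; congr (expR (_ + _)).
rewrite -[1 in RHS]Rintegral_density -RintegralB//; last 2 first.
- exact: integrable_cos_density.
- exact: integrable_density.
rewrite -RintegralZl//; last first.
  exact: (integrableB measurableT (integrable_cos_density t) integrable_density).
by apply: eq_Rintegral => x _; ring.
Qed.

End Density.

Lemma charfun_empE (n : nat) (x : 'I_n -> R) (t : R) :
  charfun_emp x t = Complex (n%:R^-1 * \sum_(j < n) cos (t * x j))
                            (n%:R^-1 * \sum_(j < n) sin (t * x j)).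
Proof.
rewrite /charfun_emp; set S := \sum_(j < n) cexp _.
have -> : S = Complex (\sum_(j < n) cos (t * x j)) (\sum_(j < n) sin (t * x j)).
  rewrite /S; elim/big_rec3: _ => [//|j a b c _ ->].
  by rewrite /cexp/= expR0 !mul1r.
by apply/eqP; rewrite eq_complex/=; apply/andP; split; apply/eqP; ring.
Qed.

End CharacteristicFunctionModulus.

(** * Size of the kernel near the origin and its moments under rescaling *)

Section Kernel.
Context {R : realType}.
Local Notation leb := (@lebesgue_measure R).
Variables (beta : R) (v : R -> R).
Hypotheses (beta0 : 0 < beta) (hv : kernel_class beta v).

Lemma kernel_continuous : continuous v.
Proof. by case: hv. Qed.

Lemma kernel_bounded : exists2 V : R, 0 < V & forall t, `|v t| <= V.
Proof.
case: hv => cv v1 _ _ _.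
have /compact_bounded[M [_ hM]] : compact (v @` `[-1, 1]).
  apply: continuous_compact; last exact: segment_compact.
  exact: continuous_subspaceT.
exists (`|M| + 1); first by rewrite ltr_pwDr.
move=> t; have [t1|t1] := leP `|t| 1; last by rewrite v1// normr0 addr_ge0.
apply: hM; first by rewrite ltr_pwDr// ler_norm.
by exists t => //=; rewrite in_itv/= -ler_norml.
Qed.

(** The O-condition speaks of a punctured neighbourhood of 0 only. It extends to t = 0 because
    continuity and beta > 0 force v(0) = 0, and to |t| >= e because there V <= (V / e^beta)
    |t|^beta. *)
Lemma kernel_powR_bound : exists2 C : R, 0 < C & forall t, `|v t| <= C * `|t| `^ beta.
Proof.
have [V V0 vV] := kernel_bounded.
case: hv => cv v1 _ _ vO.
have [k0 [_ hk0]] : \forall k \near +oo, \forall t \near 0^', `|v t| <= k * `| `|t| `^ beta|.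
  exact/eqOP.
pose k := `|k0| + 1.
have /nbhs_ballP[e /= e0 he] : \forall t \near 0^', `|v t| <= k * `| `|t| `^ beta|.
  by apply: hk0; rewrite ltr_pwDr// ler_norm.
have k_gt0 : 0 < k by rewrite ltr_pwDr.
pose e1 := e `^ beta.
have e10 : 0 < e1 by exact: powR_gt0.
have near0 t : t != 0 -> `|t| < e -> `|v t| <= k * `|t| `^ beta.
  move=> t0 te; have := he t; rewrite [`| _ `^ _ |]ger0_norm ?powR_ge0//.
  by apply => //; rewrite /ball/= sub0r normrN.
have v0 : v 0 = 0.
  apply/eqP; rewrite -normr_le0 leNgt; apply/negP => v0.
  (* A point t > 0 with t^beta <= q has |v(t)| <= |v(0)| / 4. If it is also close enough to 0 that
     |v(0) - v(t)| < |v(0)| / 2, the triangle inequality is violated. *)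
  pose q := `|v 0| / (4 * k); have q0 : 0 < q by rewrite divr_gt0// mulr_gt0.
  have /(_ (`|v 0| / 2)) : forall eps, 0 < eps -> \forall t \near 0, `|v 0 - v t| < eps.
    by move=> eps eps0; exact: (cvgrPdist_lt _ _).1 (cv 0) eps eps0.
  move=> /(_ (divr_gt0 v0 (ltr0Sn _ _)))/nbhs_ballP[e2 /= e20 he2].
  pose t := Num.min e (Num.min e2 (q `^ beta^-1)) / 2.
  have t0 : 0 < t by rewrite divr_gt0// !lt_min e0 e20 powR_gt0.
  have t2 : t < Num.min e (Num.min e2 (q `^ beta^-1)).
    by rewrite ltr_pdivrMr// mulr_natr mulr2n ltrDl; move: t0; rewrite pmulr_lgt0.
  move: t2; rewrite !lt_min => /and3P[te te2 tq].
  have := near0 t (lt0r_neq0 t0); rewrite (gtr0_norm t0) => /(_ te) vt.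
  have tb : t `^ beta <= q.
    have -> : q = (q `^ beta^-1) `^ beta by rewrite -powRrM mulVf ?gt_eqF// powRr1// ltW.
    by apply: ge0_ler_powR; rewrite ?nnegrE ?powR_ge0// ltW.
  have : `|v 0 - v t| < `|v 0| / 2 by apply: he2; rewrite /ball/= sub0r normrN gtr0_norm.
  have : `|v 0| <= `|v 0 - v t| + `|v t| by rewrite -{1}(subrK (v t) (v 0)) ler_normD.
  have : k * t `^ beta <= `|v 0| / 4.
    apply: le_trans (ler_wpM2l (ltW k_gt0) tb) _.
    suff -> : k * q = `|v 0| / 4 by [].
    by rewrite /q; field; rewrite gt_eqF.
  by move: vt; lra.
exists (k + V / e1); first by rewrite addr_gt0// divr_gt0.
move=> t; have p0 := powR_ge0 `|t| beta.
have [->|t0] := eqVneq t 0; first by rewrite v0 normr0 mulr_ge0// ?powR_ge0// addr_ge0// ltW// divr_gt0.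
have [te|te] := ltP `|t| e.
  apply: le_trans (near0 t t0 te) _; rewrite ler_wpM2r// lerDl.
  by rewrite ltW// divr_gt0.
apply: le_trans (vV t) _; rewrite mulrDl -[V in V <= _]add0r lerD//.
  by rewrite mulr_ge0// ltW.
rewrite mulrAC ler_pdivlMr// ler_wpM2l ?(ltW V0)//.
by apply: ge0_ler_powR; rewrite ?nnegrE// ltW.
Qed.

Lemma measurable_scaled_kernel (h : R) : measurable_fun setT (scaled_kernel h v).
Proof.
apply: measurable_funM => //; apply: measurableT_comp => //.
exact: continuous_measurable_fun kernel_continuous.
Qed.

Lemma Rintegral_scale (w : R -> R) (h : R) : 0 < h -> continuous w ->
  \int[leb]_(t in `[- h^-1, h^-1]) (w (h * t) * h) = \int[leb]_(s in `[-1, 1]) w s.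
Proof.
move=> h0 cw; rewrite /Rintegral; congr fine.
have hh : - h^-1 <= h^-1 by rewrite -subr_ge0 opprK addr_ge0// invr_ge0 ltW.
have dF (x : R) : is_derive x 1 ( *%R h : R -> R) h.
  by have := @is_deriveZ R R R id h x 1 1 _; rewrite /GRing.scale/= mulr1; apply; exact: is_derive_id.
have F1 : derive1 ( *%R h) = cst h by apply/funext => x; rewrite derive1E derive_val.
have := @integration_by_substitution_increasing R ( *%R h) w (- h^-1) (h^-1) hh.
rewrite mulrN divff ?gt_eqF//; move=> ->.
- by apply: eq_integral => t _; rewrite F1.
- by move=> x y _ _ xy; rewrite ltr_pM2l.
- by rewrite F1 => x _; exact: cst_continuous.
- by rewrite F1; exact: is_cvg_cst.
- by rewrite F1; exact: is_cvg_cst.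
- split => //.
  + by apply: cvg_at_right_filter; exact: mulrl_continuous.
  + by apply: cvg_at_left_filter; exact: mulrl_continuous.
- exact: continuous_subspaceT.
Qed.

Lemma Rintegral_scaled_kernel (h : R) : 0 < h ->
  \int[leb]_(t in `[- h^-1, h^-1]) scaled_kernel h v t = 0.
Proof.
move=> h0; case: hv => cv _ v0 _ _.
transitivity (\int[leb]_(t in `[- h^-1, h^-1]) (h ^+ 2 * v (h * t) * h)).
  by apply: eq_Rintegral => t _; rewrite /scaled_kernel; ring.
rewrite (@Rintegral_scale (fun s => h ^+ 2 * v s))//; last first.
  by move=> s; apply: cvgM; [exact: cvg_cst | exact: cv].
rewrite RintegralZl// ?v0 ?mulr0//.
by apply: continuous_compact_integrable; [exact: segment_compact | exact: continuous_subspaceT].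
Qed.

(** The cube in h^3 v(ht) is exactly what preserves this moment: two factors h turn t^2 into (ht)^2
    and the third is the Jacobian. *)
Lemma Rintegral_sqr_scaled_kernel (h : R) : 0 < h ->
  \int[leb]_(t in `[- h^-1, h^-1]) (- (t ^+ 2 / 2) * scaled_kernel h v t) = 1.
Proof.
move=> h0; case: hv => cv _ _ v1 _.
transitivity (\int[leb]_(t in `[- h^-1, h^-1]) (- ((h * t) ^+ 2 / 2) * v (h * t) * h)).
  by apply: eq_Rintegral => t _; rewrite /scaled_kernel; field.
rewrite (@Rintegral_scale (fun s => - (s ^+ 2 / 2) * v s))//.
move=> s; apply: cvgM; last exact: cv.
by apply: cvgN; apply: cvgM; [exact: exprn_continuous | exact: cvg_cst].
Qed.

End Kernel.

(** * Deterministic error bound for a fixed sample *)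

Section EstimatorError.
Context {R : realType}.
Local Notation leb := (@lebesgue_measure R).
Variables (beta C V : R) (v : R -> R) (f : R -> R).
Hypotheses (hv : kernel_class beta v) (C0 : 0 < C) (V0 : 0 < V)
  (vC : forall t, `|v t| <= C * `|t| `^ beta) (vV : forall t, `|v t| <= V)
  (hf : probability_density f).
Variables (L gamma sigma lambda h M c N : R) (z : R -> R[i]).
Local Notation phi := (charfun_Levy gamma sigma (fun x => lambda * f x)).
Local Notation k := (scaled_kernel h v).
Local Notation I := `[- h^-1, h^-1]%classic.
Hypotheses
  (hL : (\int[leb]_t (`|t| `^ beta * cmod (charfun_density f t))%:E <= L%:E)%E)
  (lambda0 : 0 <= lambda) (h0 : 0 < h) (M0 : 0 <= M) (c0 : 0 < c)
  (mz : measurable_fun setT (fun t => truncated_log M (z t)))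
  (md : measurable_fun setT (fun t => cmod (z t - phi t)))
  (dN : forall t, cmod (z t - phi t) <= N)
  (phic : forall t, `|t| <= h^-1 -> c <= cmod (phi t) /\ `|ln (cmod (phi t))| <= M).

Lemma leb_symmetric_itv : leb I = (2 / h)%:E.
Proof.
rewrite lebesgue_measure_itv/= lte_fin gtrN ?invr_gt0//.
by rewrite -EFinB opprK; congr EFin; field; rewrite gt_eqF.
Qed.

Let mI : @measurable _ (measurableTypeR R) I.
Proof. exact: measurable_itv. Qed.

Let finI : (leb I < +oo)%E.
Proof. by rewrite leb_symmetric_itv ltry. Qed.

Let inI (t : R) : I t -> `|t| <= h^-1.
Proof. by rewrite /= in_itv/= -ler_norml. Qed.

Let bounded_itv_integrable (g : R -> R) (B : R) : measurable_fun setT g ->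
  (forall t, `|t| <= h^-1 -> `|g t| <= B) -> leb.-integrable I (EFin \o g).
Proof.
move=> mg gB; apply: (@bounded_fun_integrable _ _ _ _ _ _ B) => //.
  exact: measurable_funTS.
by move=> t /inI; exact: gB.
Qed.

Let kV (t : R) : `|k t| <= h ^+ 3 * V.
Proof.
have h3 : 0 <= h ^+ 3 by rewrite exprn_ge0 // ltW.
by rewrite normrM ger0_norm// ler_wpM2l.
Qed.

Let mk : measurable_fun setT k.
Proof. exact: measurable_scaled_kernel hv h. Qed.

Let mul_kernel_integrable (g : R -> R) (B : R) : measurable_fun setT g ->
  (forall t, `|t| <= h^-1 -> `|g t| <= B) ->
  leb.-integrable I (EFin \o (fun t => g t * k t)).
Proof.
move=> mg gB; apply: (@bounded_itv_integrable _ (B * (h ^+ 3 * V))).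
  exact: measurable_funM.
by move=> t ti; rewrite normrM ler_pM// gB.
Qed.

(** On the kernel side |v^h(t)| <= C h^3 h^beta |t|^beta, and |Re phi_f| <= |phi_f|, so the weighted
    integral bounded by L dominates. *)
Lemma kernel_bias_bound :
  `|\int[leb]_(t in I) (charfun_density_Re f t * k t)|
    <= C * (h ^+ 3 * h `^ beta) * L.
Proof.
set D := C * _.
have D0 : 0 < D by rewrite mulr_gt0// mulr_gt0// ?exprn_gt0// powR_gt0.
have mr := measurable_charfun_density_Re hf.
have rk_int : leb.-integrable I (EFin \o (fun t => charfun_density_Re f t * k t)).
  by apply: (@mul_kernel_integrable _ 1) => // t _; exact: charfun_density_Re_bounded.
(* Dividing by [D] makes the integrand directly comparable with that of [hL], an extended-real
   integral of a function not known here to be measurable. *)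
pose g t := D^-1 * (charfun_density_Re f t * k t).
have g_int : leb.-integrable I (EFin \o g).
  exact: (integrableZl mI D^-1 rk_int).
rewrite -ler_pdivrMl// -[X in X * _](@ger0_norm _ D^-1) ?invr_ge0 ?(ltW D0)// -normrM.
rewrite -RintegralZl//.
apply: le_trans (le_normr_Rintegral mI g_int) _.
rewrite -lee_fin; apply: le_trans hL.
rewrite /Rintegral fineK; last exact: integrable_fin_num (integrable_norm g_int).
rewrite integral_mkcond; apply: ge0_le_integral_unmeasurable => t.
  by apply: erestrict_ge0 => x _; rewrite lee_fin.
rewrite patchE; case: ifPn => _; rewrite lee_fin; last first.
  by rewrite mulr_ge0 ?powR_ge0 ?cmod_ge0.
rewrite normrM [`|D^-1|]ger0_norm ?invr_ge0 ?(ltW D0)// ler_pdivrMl// normrM.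
have kt : `|k t| <= D * `|t| `^ beta.
  have h3 : 0 <= h ^+ 3 by rewrite exprn_ge0 // ltW.
  rewrite normrM ger0_norm//; apply: le_trans (ler_wpM2l h3 (vC _)) _.
  rewrite normrM powRM// ger0_norm ?(ltW h0)//.
  suff -> : h ^+ 3 * (C * (h `^ beta * `|t| `^ beta)) = D * `|t| `^ beta by [].
  by rewrite /D; ring.
rewrite mulrA [leLHS]mulrC ler_pM//.
by rewrite -Re_charfun_density normr_Re_le_cmod.
Qed.

(** Here [z] stands for one realization of the empirical characteristic function and [c] for a lower
    bound of |phi| on the integration range. The bound [N] makes |z - phi| integrable. *)
Lemma estimator_error_bound :
  `|\int[leb]_(t in I) (truncated_log M (z t) * k t) - sigma ^+ 2|
    <= lambda * (C * (h ^+ 3 * h `^ beta) * L)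
       + (2 + 4 * M) / c * (h ^+ 3 * V) *
         \int[leb]_(t in I) cmod (z t - phi t).
Proof.
have mr := measurable_charfun_density_Re hf.
have mt2 : measurable_fun setT (fun t : R => - (t ^+ 2 / 2)).
  by apply: measurable_funN; apply: measurable_funM.
pose psi t := - (sigma ^+ 2 * t ^+ 2 / 2) + lambda * (charfun_density_Re f t - 1).
have lnphi t : ln (cmod (phi t)) = psi t.
  by rewrite cmod_charfun_Levy_density// expRK.
have mpsi : measurable_fun setT psi.
  apply: measurable_funD.
    by apply: measurable_funN; do 2 apply: measurable_funM => //.
  by apply: measurable_funM => //; exact: measurable_funB.
have i_tl : leb.-integrable I (EFin \o (fun t => truncated_log M (z t) * k t)).
  by apply: (@mul_kernel_integrable _ M) => // t _; exact: truncated_log_bounded.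
have i_psi : leb.-integrable I (EFin \o (fun t => psi t * k t)).
  by apply: (@mul_kernel_integrable _ M) => // t /phic[_]; rewrite lnphi.
have i_r : leb.-integrable I (EFin \o (fun t => charfun_density_Re f t * k t)).
  by apply: (@mul_kernel_integrable _ 1) => // t _; exact: charfun_density_Re_bounded.
have i_k : leb.-integrable I (EFin \o k).
  by apply: (@bounded_itv_integrable _ (h ^+ 3 * V)).
have i_t2 : leb.-integrable I (EFin \o (fun t => - (t ^+ 2 / 2) * k t)).
  apply: (@mul_kernel_integrable _ (h^-1 ^+ 2 / 2)) => // t th.
  rewrite normrN normrM [`|2^-1|]ger0_norm// ler_wpM2r// normrX.
  by rewrite lerXn2r ?nnegrE// invr_ge0 ltW.
have i_d : leb.-integrable I (EFin \o (fun t => cmod (z t - phi t))).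
  by apply: (@bounded_itv_integrable _ N) => // t _; rewrite ger0_norm ?cmod_ge0.
have psiE : \int[leb]_(t in I) (psi t * k t) =
    sigma ^+ 2 + lambda * \int[leb]_(t in I) (charfun_density_Re f t * k t).
  have -> : \int[leb]_(t in I) (psi t * k t) = \int[leb]_(t in I)
     (sigma ^+ 2 * (- (t ^+ 2 / 2) * k t) +
       (lambda * (charfun_density_Re f t * k t) + (- lambda) * k t)).
    by apply: eq_Rintegral => t _; rewrite /psi; field.
  have j1 := integrableZl mI (sigma ^+ 2) i_t2.
  have j2 := integrableZl mI lambda i_r.
  have j3 := integrableZl mI (- lambda) i_k.
  rewrite RintegralD//; last exact: (integrableD mI j2 j3).
  rewrite RintegralD// RintegralZl// RintegralZl// RintegralZl//.
  rewrite (Rintegral_sqr_scaled_kernel hv h0) (Rintegral_scaled_kernel hv h0).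
  by rewrite mulr1 mulr0 addr0.
(* Inserting ln |phi| splits the error into the bias and the integral of the pointwise logarithmic
   error. *)
have -> : \int[leb]_(t in I) (truncated_log M (z t) * k t) - sigma ^+ 2 =
    lambda * \int[leb]_(t in I) (charfun_density_Re f t * k t) +
    \int[leb]_(t in I) (truncated_log M (z t) * k t - psi t * k t).
  by rewrite RintegralB// psiE; ring.
apply: le_trans (ler_normD _ _) _; apply: lerD.
  by rewrite normrM ger0_norm// ler_wpM2l// kernel_bias_bound.
have i_B : leb.-integrable I (EFin \o (fun t => truncated_log M (z t) * k t - psi t * k t)).
  exact: (integrableB mI i_tl i_psi).
apply: le_trans (le_normr_Rintegral mI i_B) _.
rewrite -RintegralZl//; apply: le_Rintegral => //.
- exact: integrable_norm.
- exact: (integrableZl mI _ i_d).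
move=> t /inI th; rewrite -mulrBl normrM.
have [pc plnM] := phic th.
have p0 : 0 < cmod (phi t) by exact: lt_le_trans pc.
have := truncated_log_dist (z t) p0 plnM; rewrite lnphi => dist.
apply: le_trans (ler_pM _ _ dist (kV t)) _ => //.
set D := cmod (z t - phi t); set p := cmod (phi t).
have -> : (2 + 4 * M) / c * (h ^+ 3 * V) * D = (2 + 4 * M) * (D / c) * (h ^+ 3 * V) by ring.
rewrite ler_wpM2r//; first by rewrite mulr_ge0// ?exprn_ge0// ltW.
rewrite ler_wpM2l//; first by rewrite addr_ge0// mulr_ge0.
by rewrite ler_wpM2l ?cmod_ge0// lef_pV2.
Qed.

End EstimatorError.

Lemma normr_mean_le1 (R : realType) (n : nat) (y : 'I_n -> R) :
  (0 < n)%N -> (forall j, `|y j| <= 1) -> `|n%:R^-1 * \sum_(j < n) y j| <= 1.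
Proof.
move=> n0 y1; rewrite normrM ger0_norm ?invr_ge0// ler_pdivrMl ?ltr0n// mulr1.
apply: le_trans (ler_norm_sum _ _ _) _.
apply: le_trans (ler_sum _ (fun j _ => y1 j)) _.
by rewrite sumr_const card_ord.
Qed.

(** * Mean square error of the empirical characteristic function *)

Section EmpiricalCharacteristicFunction.
Context d (T : measurableType d) (R : realType) (P : probability T R).
Local Notation leb := (@lebesgue_measure R).
Variables (n : nat) (X : 'I_n -> {RV P >-> R}) (gamma sigma : R) (rho : R -> R).
Hypotheses (n0 : (0 < n)%N) (hX : iid_Levy_sample X gamma sigma rho).

Lemma mutually_independent_pair (i j : 'I_n) : i != j ->
  forall A B, measurable A -> measurable B ->
  (P ((X i @^-1` A) `&` (X j @^-1` B)) = P (X i @^-1` A) * P (X j @^-1` B))%E.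
Proof.
move=> ij A B mA mB; case: hX => indep _ _.
have := indep (i |: [set j])%SET (fun l => if l == i then A else B).
rewrite big_setU1 ?finset.inE//= big_set1 eqxx eq_sym (negbTE ij).
have -> : \bigcap_(l in [set` (i |: [set j])%SET]) (X l @^-1` (if l == i then A else B)) =
    (X i @^-1` A) `&` (X j @^-1` B).
  apply/seteqP; split => w /=.
    move=> h; split; first by have /= := h i; rewrite !finset.inE eqxx; exact.
    by have /= := h j; rewrite !finset.inE eqxx orbT eq_sym (negbTE ij); exact.
  move=> [hi hj] l /=; rewrite !finset.inE => /orP[] /eqP -> /=; first by rewrite eqxx.
  by rewrite eq_sym (negbTE ij).
by apply; move=> l; case: ifP.
Qed.

Lemma Re_charfun_sample (i : 'I_n) (t : R) :
  \int[P]_w cos (t * X i w) = complex.Re (charfun_Levy gamma sigma rho t).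
Proof.
case: hX => _ _ /(_ i t) <-.
by apply: eq_Rintegral => w _ /=; rewrite expR0 mul1r.
Qed.

Lemma Im_charfun_sample (i : 'I_n) (t : R) :
  \int[P]_w sin (t * X i w) = complex.Im (charfun_Levy gamma sigma rho t).
Proof.
case: hX => _ _ /(_ i t) <-.
by apply: eq_Rintegral => w _ /=; rewrite expR0 mul1r.
Qed.

Lemma cmod_charfun_emp_diff_sqr (x : 'I_n -> R) (t : R) :
  cmod (charfun_emp x t - charfun_Levy gamma sigma rho t) ^+ 2 =
  (n%:R^-1 * \sum_(j < n) cos (t * x j)
     - complex.Re (charfun_Levy gamma sigma rho t)) ^+ 2 +
  (n%:R^-1 * \sum_(j < n) sin (t * x j)
     - complex.Im (charfun_Levy gamma sigma rho t)) ^+ 2.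
Proof.
rewrite charfun_empE; case: (charfun_Levy _ _ _ _) => a b.
by rewrite [LHS]sqr_sqrtr// addr_ge0// sqr_ge0.
Qed.

Let trig_mul_measurable (g : R -> R) (i : 'I_n) : continuous g ->
  measurable_fun setT (fun z : R * T => g (z.1 * X i z.2)).
Proof.
move=> cg; apply: measurableT_comp; first exact: continuous_measurable_fun.
by apply: measurable_funM => //; exact: measurableT_comp.
Qed.

(** Measurability in t is read off the sample: the function is the characteristic function of an
    observation, hence a parameter integral over [P] of a bounded, jointly measurable function. *)
Lemma measurable_charfun_sample :
  measurable_fun setT (fun t => complex.Re (charfun_Levy gamma sigma rho t)) /\
  measurable_fun setT (fun t => complex.Im (charfun_Levy gamma sigma rho t)).
Proof.
pose i := Ordinal n0.
have par (g : R -> R) : continuous g -> (forall x, `|g x| <= 1) ->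
    measurable_fun setT (fun t : R => \int[P]_w g (t * X i w)).
  move=> cg g1.
  have -> : (fun t : R => \int[P]_w g (t * X i w)) =
      (fun t : R => \int[P]_w (g (t * X i w) * 1)).
    by apply/funext => t; apply: eq_Rintegral => w _; rewrite mulr1.
  apply: (@measurable_bounded_param_Rintegral _ _ _ P
    (fun z => g (z.1 * X i z.2)) (fun=> 1)) => //.
    exact: trig_mul_measurable.
  by apply: bounded_fun_integrableT => //; exists 1 => x; rewrite normr1.
split.
  under eq_fun do rewrite -(Re_charfun_sample i).
  by apply: par; [exact: continuous_cos | move=> x; rewrite ler_norml cos_geN1 cos_le1].
under eq_fun do rewrite -(Im_charfun_sample i).
by apply: par; [exact: continuous_sin | move=> x; rewrite ler_norml sin_geN1 sin_le1].
Qed.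

(** Joint measurability in t and the outcome is what Tonelli's theorem asks for below. *)
Lemma measurable_charfun_emp_diff :
  measurable_fun setT (fun z : R * T =>
    cmod (charfun_emp (fun j => X j z.2) z.1 - charfun_Levy gamma sigma rho z.1)).
Proof.
have [mRe mIm] := measurable_charfun_sample.
have -> : (fun z : R * T =>
    cmod (charfun_emp (fun j => X j z.2) z.1 - charfun_Levy gamma sigma rho z.1)) =
  Num.sqrt \o (fun z : R * T =>
    (n%:R^-1 * \sum_(j < n) cos (z.1 * X j z.2)
     - complex.Re (charfun_Levy gamma sigma rho z.1)) ^+ 2 +
    (n%:R^-1 * \sum_(j < n) sin (z.1 * X j z.2)
     - complex.Im (charfun_Levy gamma sigma rho z.1)) ^+ 2).
  apply/funext => z /=; rewrite -cmod_charfun_emp_diff_sqr sqrtr_sqr ger0_norm//.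
  exact: cmod_ge0.
apply: measurableT_comp; first exact: continuous_measurable_fun (@sqrt_continuous R).
have mean (g : R -> R) : continuous g ->
    measurable_fun setT (fun z : R * T => n%:R^-1 * \sum_(j < n) g (z.1 * X j z.2)).
  move=> cg; apply: measurable_funM => //; apply: measurable_sum => i.
  exact: trig_mul_measurable.
apply: measurable_funD; apply: measurable_funX; apply: measurable_funB.
- exact: mean (@continuous_cos R).
- exact: measurableT_comp mRe _.
- exact: mean (@continuous_sin R).
- exact: measurableT_comp mIm _.
Qed.

Let measurable_trig_dilation (g : R -> R) (t : R) : continuous g ->
  measurable_fun setT (fun x : R => g (t * x)).
Proof.
by move=> cg; apply: measurableT_comp => //; exact: continuous_measurable_fun.
Qed.

Let cos_bounded (x : R) : `|cos x| <= 1.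
Proof. by rewrite ler_norml cos_geN1 cos_le1. Qed.

Let sin_bounded (x : R) : `|sin x| <= 1.
Proof. by rewrite ler_norml sin_geN1 sin_le1. Qed.

Let mean_sqr_integrable (g : R -> R) (c : R) : measurable_fun setT g -> (forall x, `|g x| <= 1) ->
    P.-integrable setT (EFin \o (fun w => (n%:R^-1 * \sum_(j < n) g (X j w) - c) ^+ 2)).
Proof.
move=> mg g1; apply: bounded_fun_integrableT.
  apply/measurable_funX/measurable_funB => //; apply: measurable_funM => //.
  by apply: measurable_sum => j; exact: measurableT_comp.
exists ((1 + `|c|) ^+ 2) => w.
rewrite normrX lerXn2r ?nnegrE ?addr_ge0//; apply: le_trans (ler_normB _ _) _.
by rewrite lerD2r normr_mean_le1.
Qed.

Lemma integrable_charfun_emp_diff_sqr (t : R) :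
  P.-integrable setT (EFin \o (fun w =>
    cmod (charfun_emp (fun j => X j w) t - charfun_Levy gamma sigma rho t) ^+ 2)).
Proof.
have -> : (fun w =>
    cmod (charfun_emp (fun j => X j w) t - charfun_Levy gamma sigma rho t) ^+ 2) =
    (fun w => (n%:R^-1 * \sum_(j < n) cos (t * X j w)
     - complex.Re (charfun_Levy gamma sigma rho t)) ^+ 2 +
    (n%:R^-1 * \sum_(j < n) sin (t * X j w)
     - complex.Im (charfun_Levy gamma sigma rho t)) ^+ 2).
  by apply/funext => w; exact: cmod_charfun_emp_diff_sqr.
have i1 := mean_sqr_integrable (complex.Re (charfun_Levy gamma sigma rho t))
  (measurable_trig_dilation t (@continuous_cos R)) (fun x => cos_bounded (t * x)).
have i2 := mean_sqr_integrable (complex.Im (charfun_Levy gamma sigma rho t))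
  (measurable_trig_dilation t (@continuous_sin R)) (fun x => sin_bounded (t * x)).
exact: (integrableD measurableT i1 i2).
Qed.

(** The cosine and sine parts each contribute (2 * 1)^2 / n. *)
Lemma charfun_emp_mse (t : R) :
  \int[P]_w (cmod (charfun_emp (fun j => X j w) t - charfun_Levy gamma sigma rho t) ^+ 2)
    <= 8 / n%:R.
Proof.
have h1 := Rintegral_sqr_mean_le n0 (measurable_trig_dilation t (@continuous_cos R))
  (fun x => cos_bounded (t * x)) mutually_independent_pair (Re_charfun_sample^~ t).
have h2 := Rintegral_sqr_mean_le n0 (measurable_trig_dilation t (@continuous_sin R))
  (fun x => sin_bounded (t * x)) mutually_independent_pair (Im_charfun_sample^~ t).
under eq_Rintegral do rewrite cmod_charfun_emp_diff_sqr.
rewrite RintegralD//; last 2 first.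
- exact: (mean_sqr_integrable _ (measurable_trig_dilation t (@continuous_cos R))
    (fun x => cos_bounded (t * x))).
- exact: (mean_sqr_integrable _ (measurable_trig_dilation t (@continuous_sin R))
    (fun x => sin_bounded (t * x))).
apply: le_trans (lerD h1 h2) _.
by rewrite -mulrDl ler_wpM2r ?invr_ge0//; lra.
Qed.

Section Integrated.
Variables (h : R) (h0 : 0 < h).
Local Notation I := (`[- h^-1, h^-1]%classic).

(** The range of t is encoded as an indicator so that Tonelli's theorem applies on the whole product
    space. *)
Let F (z : R * T) : \bar R := (\1_I z.1 *
  cmod (charfun_emp (fun j => X j z.2) z.1 - charfun_Levy gamma sigma rho z.1) ^+ 2)%:E.

Let mF : measurable_fun setT F.
Proof.
have mI : @measurable _ (measurableTypeR R) I by exact: measurable_itv.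
apply/measurable_EFinP/measurable_funM.
  exact: (measurableT_comp (measurable_indic mI) measurable_fst).
by apply: measurable_funX; exact: measurable_charfun_emp_diff.
Qed.

Let F0 z : (0 <= F z)%E.
Proof. by rewrite lee_fin mulr_ge0// sqr_ge0. Qed.

Let FE (w : T) : (\int[leb]_(t in I)
    (cmod (charfun_emp (fun j => X j w) t - charfun_Levy gamma sigma rho t) ^+ 2)%:E
  = \int[leb]_t F (t, w))%E.
Proof.
rewrite integral_mkcond; apply: eq_integral => t _.
by rewrite patchE /F/= indicE; case: ifPn => _; rewrite ?mul1r ?mul0r.
Qed.

Lemma measurable_integrated_charfun_emp_diff :
  measurable_fun setT (fun w => \int[leb]_(t in I)
    (cmod (charfun_emp (fun j => X j w) t - charfun_Levy gamma sigma rho t) ^+ 2)%:E)%E.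
Proof.
under eq_fun do rewrite FE.
exact: (@measurable_fun_fubini_tonelli_G _ _ _ _ R leb F mF F0).
Qed.

Lemma integrated_charfun_emp_mse :
  (\int[P]_w \int[leb]_(t in I)
     (cmod (charfun_emp (fun j => X j w) t - charfun_Levy gamma sigma rho t) ^+ 2)%:E
   <= (8 / n%:R * (2 / h))%:E)%E.
Proof.
under eq_integral do rewrite FE.
have FT := @fubini_tonelli _ _ _ _ R leb P F mF F0.
rewrite -FT.
have -> : (8 / n%:R * (2 / h))%:E = (\int[leb]_(t in I) (8 / n%:R)%:E)%E.
  rewrite integral_cst; last exact: measurable_itv.
  by rewrite [X in (_ = _ * X)%E](leb_symmetric_itv h0) EFinM.
rewrite [leRHS]integral_mkcond; apply: ge0_le_integral_unmeasurable => t.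
  exact: integral_ge0.
rewrite patchE /F/=; under eq_integral do rewrite indicE.
case: ifPn => tI; last by rewrite integral0_eq// => w _; rewrite mul0r.
under eq_integral do rewrite mul1r.
rewrite -[leLHS]fineK ?lee_fin; first exact: charfun_emp_mse.
exact: integrable_fin_num (integrable_charfun_emp_diff_sqr t).
Qed.

End Integrated.

End EmpiricalCharacteristicFunction.

(** With l = log n, this lets a negative power of n absorb any power of log n. For an integer N >=
    p, l^p <= l^N since l >= 1, and l = (N / a) (a l / N) <= (N / a) exp(a l / N). *)
Lemma powR_expR_bounded (R : realType) (p a : R) : 0 < a ->
  exists2 B : R, 0 < B & forall l, 1 <= l -> l `^ p * expR (- (a * l)) <= B.
Proof.
move=> a0; pose N := (Num.truncn `|p|).+1.
have N0 : 0 < N%:R :> R by rewrite ltr0n.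
have pN : p <= N%:R.
  by apply: le_trans (ler_norm _) _; rewrite ltW// truncnS_gt.
exists ((N%:R / a) ^+ N); first by rewrite exprn_gt0// divr_gt0.
move=> l l1; have l0 : 0 < l by rewrite (lt_le_trans _ l1).
rewrite expRN ler_pdivrMr ?expR_gt0//.
apply: (@le_trans _ _ (l ^+ N)).
  by rewrite -powR_mulrn ?(ltW l0)// ler_powR.
have -> : expR (a * l) = expR (a * l / N%:R) ^+ N.
  by rewrite -expRM_natr mulfVK ?gt_eqF.
rewrite -exprMn lerXn2r ?nnegrE ?mulr_ge0 ?expR_ge0 ?invr_ge0 ?(ltW l0) ?(ltW a0)//.
have le_l : l = N%:R / a * (a * l / N%:R).
  by field; rewrite !gt_eqF.
rewrite [leLHS]le_l ler_wpM2l ?divr_ge0 ?(ltW a0)//.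
by apply: le_trans (expR_ge1Dx _); rewrite lerDr.
Qed.

(** * Risk bound at a fixed sample size *)

Section EstimatorMse.
Context {R : realType}.
Local Notation leb := (@lebesgue_measure R).

Lemma cmodB_le (a b : R[i]) : cmod (a - b) <= cmod a + cmod b.
Proof.
by apply: le_trans (complex.le_normcD a (- b)) _; rewrite lerD2l; rewrite /cmod complex.normcN.
Qed.

Lemma cmod_le_ReIm (x y : R) : cmod (Complex x y) <= `|x| + `|y|.
Proof.
rewrite cmodE -[leRHS]ger0_norm ?addr_ge0// -sqrtr_sqr ler_wsqrtr//.
rewrite sqrrD !real_normK ?num_real//.
by rewrite -addrA lerD2l lerDr mulrn_wge0// mulr_ge0.
Qed.

(** Of the two factors 2 / h, one is the Cauchy-Schwarz constant of the integration interval and the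
    other comes from integrating the bound 8 / n over that interval. *)
Lemma estimator_mse (beta C V : R) (v f : R -> R) (L gamma sigma lambda c : R)
    (eta : R) (m : nat -> R) (n : nat)
    d (T : measurableType d) (P : probability T R) (X : 'I_n -> {RV P >-> R}) :
  let h := bandwidth eta n in let M := truncation eta m n in
  let phi := charfun_Levy gamma sigma (fun x => lambda * f x) in
  kernel_class beta v -> 0 < C -> 0 < V ->
  (forall t, `|v t| <= C * `|t| `^ beta) -> (forall t, `|v t| <= V) ->
  probability_density f ->
  (\int[leb]_t (`|t| `^ beta * cmod (charfun_density f t))%:E <= L%:E)%E ->
  (0 < n)%N -> 0 <= lambda -> 0 < h -> 0 <= M -> 0 < c ->
  (forall t, `|t| <= h^-1 -> c <= cmod (phi t) /\ `|ln (cmod (phi t))| <= M) ->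
  iid_Levy_sample X gamma sigma (fun x => lambda * f x) ->
  ('E_P[(fun w => (sigma2_tilde v eta m (fun j => X j w) - sigma ^+ 2) ^+ 2)%R]
    <= (2 * (lambda * (C * (h ^+ 3 * h `^ beta) * L)) ^+ 2
        + 2 * ((2 + 4 * M) / c * (h ^+ 3 * V)) ^+ 2 * (2 / h)
          * (8 / n%:R * (2 / h)))%:E)%E.
Proof.
move=> h M phi hv C0 V0 vC vV hf hL n0 lambda0 h0 M0 c0 phic hX.
pose I := `[- h^-1, h^-1]%classic.
have mI : @measurable _ (measurableTypeR R) I by exact: measurable_itv.
have lI : leb I = (2 / h)%:E by exact: leb_symmetric_itv.
have fI : fine (leb I) = 2 / h by rewrite lI.
have finI : (leb I < +oo)%E by rewrite lI ltry.
pose delta w t := cmod (charfun_emp (fun j => X j w) t - phi t).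
have mdelta := measurable_charfun_emp_diff n0 hX.
have mdw w : measurable_fun setT (delta w) by exact: (measurable_fun_pair1 w mdelta).
have phi1 t : cmod (phi t) <= 1.
  rewrite /phi cmod_charfun_Levy_density// -[leRHS]expR0 ler_expR.
  have := charfun_density_Re_bounded hf t; rewrite ler_norml => /andP[_ r1].
  have : 0 <= sigma ^+ 2 * t ^+ 2 / 2 by rewrite divr_ge0// mulr_ge0// sqr_ge0.
  have : 0 <= lambda * (1 - charfun_density_Re f t) by rewrite mulr_ge0// subr_ge0.
  lra.
(* A crude bound, 1 + 1 for the two parts of phi_emp plus 1 for phi; it is used for integrability
   only. *)
have delta3 w t : delta w t <= 3.
  apply: le_trans (cmodB_le _ _) _.
  have -> : 3 = (1 + 1) + 1 :> R by ring.
  apply: lerD; last exact: phi1.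
  rewrite charfun_empE; apply: le_trans (cmod_le_ReIm _ _) _.
  by apply: lerD; apply: normr_mean_le1 => // j;
    rewrite ler_norml ?cos_geN1 ?cos_le1 ?sin_geN1 ?sin_le1.
have delta0 w t : 0 <= delta w t by exact: cmod_ge0.
set A := lambda * _; set B := (2 + 4 * M) / c * (h ^+ 3 * V).
have [h_ge0 c_ge0 V_ge0] : [/\ 0 <= h, 0 <= c & 0 <= V] by split; exact: ltW.
have B0 : 0 <= B.
  rewrite mulr_ge0//; last by rewrite mulr_ge0// exprn_ge0.
  by rewrite divr_ge0// addr_ge0// mulr_ge0.
have mtl (x : 'I_n -> R) : measurable_fun setT (fun t => truncated_log M (charfun_emp x t)).
  under eq_fun do rewrite charfun_empE.
  have mean (g : R -> R) : continuous g ->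
      measurable_fun setT (fun t : R => n%:R^-1 * \sum_(j < n) g (t * x j)).
    move=> cg; apply: measurable_funM => //; apply: measurable_sum => j.
    apply: measurableT_comp; first exact: continuous_measurable_fun.
    exact: measurable_funM.
  by apply: measurable_truncated_log => //; apply: mean;
    [exact: continuous_cos | exact: continuous_sin].
have main w : (sigma2_tilde v eta m (fun j => X j w) - sigma ^+ 2) ^+ 2 <=
    2 * A ^+ 2 + 2 * B ^+ 2 * (2 / h) * \int[leb]_(t in I) (delta w t ^+ 2).
  have e1 := @estimator_error_bound R beta C V v f hv C0 V0 vC vV hf L gamma sigma lambda
    h M c 3 (charfun_emp (fun j => X j w)) hL lambda0 h0 M0 c0 (mtl _) (mdw w)
    (delta3 w) phic.
  have d3 t : I t -> `|delta w t| <= 3 by rewrite ger0_norm.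
  pose J := \int[leb]_(t in I) delta w t.
  set K := \int[leb]_(t in I) (delta w t ^+ 2).
  have e2 : J ^+ 2 <= 2 / h * K.
    by rewrite -fI; exact: sqr_Rintegral_le mI finI (measurable_funTS (mdw w)) d3.
  set s := sigma2_tilde _ _ _ _ - _.
  have {}e1 : `|s| <= A + B * J := e1.
  rewrite -[leLHS]real_normK ?num_real//.
  apply: (@le_trans _ _ ((A + B * J) ^+ 2)).
    by rewrite lerXn2r ?nnegrE// (le_trans _ e1).
  apply: (@le_trans _ _ (2 * A ^+ 2 + 2 * B ^+ 2 * J ^+ 2)).
    by have := sqr_ge0 (A - B * J); rewrite -subr_ge0; lra.
  by rewrite lerD2l -[leRHS]mulrA ler_wpM2l// mulr_ge0// sqr_ge0.
rewrite unlock; set Q := 2 * B ^+ 2 * (2 / h) in main *.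
have Q0 : 0 <= Q by rewrite mulr_ge0 ?divr_ge0// mulr_ge0// sqr_ge0.
have iK w : leb.-integrable I (EFin \o (fun t => delta w t ^+ 2)).
  apply: (@bounded_fun_integrable _ _ _ _ _ _ (3 ^+ 2)) => //.
    by apply: measurable_funTS; apply: measurable_funX; exact: mdw.
  move=> t _; rewrite normrX ger0_norm// lerXn2r ?nnegrE//.
pose K w := (\int[leb]_(t in I) (delta w t ^+ 2)%:E)%E.
have mK : measurable_fun setT K.
  exact: measurable_integrated_charfun_emp_diff n0 hX h.
have K0 w : (0 <= K w)%E by apply: integral_ge0 => t _; rewrite lee_fin sqr_ge0.
(* From here on only the dominating function is integrated; its measurability, [mK], justifies
   linearity. *)
apply: (@le_trans _ _ (\int[P]_w ((2 * A ^+ 2)%:E + Q%:E * K w))%E).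
  apply: ge0_le_integral_unmeasurable => w; first by rewrite lee_fin sqr_ge0.
  rewrite /K -[(\int[leb]_(t in _) _)%E]fineK; last exact: integrable_fin_num (iK w).
  by rewrite -EFinM -EFinD lee_fin; exact: main.
rewrite ge0_integralD//; last 3 first.
- by move=> w _; rewrite lee_fin mulr_ge0// sqr_ge0.
- by move=> w _; rewrite mule_ge0.
- exact: measurable_funeM.
rewrite integral_cst// ge0_integralZl//.
have -> : ((2 * A ^+ 2)%:E * P setT = (2 * A ^+ 2)%:E)%E.
  by have -> : P setT = 1%E; [exact: probability_setT | rewrite mule1].
rewrite EFinD leeD2l// [leRHS]EFinM lee_wpmul2l ?lee_fin//.
have bound := integrated_charfun_emp_mse n0 hX h0.
exact: bound.
Qed.

End EstimatorMse.

(** * Powers of the bandwidth and the uniform rate *)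

Section Rates.
Context {R : realType}.

Lemma bandwidth_powers (eta : R) (n : nat) : 0 < eta -> 1 <= ln n%:R :> R ->
  let h := bandwidth eta n in let u := eta * ln n%:R in
  [/\ 0 < h, h ^- 2 = u &
      forall beta, (h ^+ 3 * h `^ beta) ^+ 2 = u `^ (- beta - 3)].
Proof.
move=> eta0 l1 h u.
have u0 : 0 < u by rewrite mulr_gt0// (lt_le_trans _ l1).
have h0 : 0 < h by exact: powR_gt0.
have hX (p : nat) : h ^+ p = u `^ (- 2^-1 * p%:R) by rewrite -powR_mulrn ?ltW// powRrM.
split => // [|beta].
  rewrite hX -powRN.
  have -> : - (- 2^-1 * 2%:R) = 1 :> R by field.
  by rewrite powRr1// ltW.
have hb : h `^ beta = u `^ (- 2^-1 * beta) by rewrite powRrM.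
rewrite hX hb -powRD; last by rewrite (gt_eqF u0) implybT.
rewrite -powR_mulrn ?powR_ge0// -powRrM; congr (_ `^ _).
by field.
Qed.

End Rates.

Theorem theorem2p1 (R : realType) (beta L Lambda K Sigma Gamma : R)
    (hbeta : 0 < beta) (hL : 0 < L) (hLambda : 0 < Lambda) (hK : 0 < K)
    (hSigma : 0 < Sigma) (hGamma : 0 < Gamma)
    (v : R -> R) (hv : kernel_class beta v)
    (eta : R) (heta0 : 0 < eta) (heta1 : eta < Sigma ^- 2)
    (m : nat -> R) (hm_infty : m @ \oo --> +oo)
    (hm_slow : m =o_\oo (fun n : nat => ln n%:R : R))
    (hM : forall n : nat, (1 < n)%N -> 0 < truncation eta m n) :
  exists (A : R) (n0 : nat), 0 < A /\
    forall n : nat, (n0 <= n)%N ->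
    forall (gamma sigma : R) (rho : R -> R),
      `|gamma| <= Gamma -> 0 < sigma <= Sigma ->
      class_W beta L Lambda K rho ->
    forall (d : measure_display) (T : measurableType d) (P : probability T R)
      (X : 'I_n -> {RV P >-> R}),
      iid_Levy_sample X gamma sigma rho ->
      ('E_P[(fun w => (sigma2_tilde v eta m (fun j => X j w) - sigma ^+ 2) ^+ 2)%R]
        <= (A * ln n%:R `^ (- beta - 3))%:E)%E.
Proof.
have [V V0 vV] := kernel_bounded hv.
have [C C0 vC] := kernel_powR_bound hbeta hv.
pose kappa := Sigma ^+ 2 * eta.
have kappa1 : kappa < 1.
  by rewrite /kappa mulrC -ltr_pdivlMr ?exprn_gt0// div1r.
have kappa0 : 0 <= kappa by rewrite mulr_ge0 ?sqr_ge0 ?(ltW heta0).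
have a0 : 0 < 1 - kappa by rewrite subr_gt0.
(* The exponent adds the 4 from M^2 = O(l^4), where l = log n, to the beta + 3 of the target
   rate. *)
have [B B0 hB] := powR_expR_bounded (beta + 7) a0.
pose A1 := 2 * (Lambda * C * L) ^+ 2 * eta `^ (- beta - 3).
(* In the stochastic term 64 = 2 * 2 * 8 * 2, [2 + 4 * eta] comes from M <= eta l^2,
   [expR (4 * Lambda)] from c^(-2), and [eta ^- 2] from h^4 = (eta l)^(-2). *)
pose A2 := 64 * (2 + 4 * eta) ^+ 2 * V ^+ 2 * expR (4 * Lambda) * eta ^- 2 * B.
have A10 : 0 < A1.
  by rewrite mulr_gt0 ?powR_gt0// mulr_gt0// exprn_gt0// !mulr_gt0.
have A20 : 0 < A2.
  have e0 : 0 < 2 + 4 * eta by rewrite addr_gt0// mulr_gt0.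
  by rewrite !mulr_gt0 ?invr_gt0 ?exprn_gt0 ?expR_gt0.
(* As l >= 1, this threshold gives M_n = m_n eta l >= kappa l / 2 + 2 Lambda, a uniform bound for
   |log |phi_X|| on |t| <= 1/h. *)
have m_large : \forall n \near \oo, (kappa / 2 + 2 * Lambda) / eta <= m n.
  exact: (cvgryPge _).1 hm_infty _.
have m_small : \forall n \near \oo, `|m n| <= 1 * `|ln n%:R : R|.
  exact: (eqoP _ _ _).1 hm_slow 1 ltr01.
have [n1 _ hn1] : \forall n \near \oo,
    (kappa / 2 + 2 * Lambda) / eta <= m n /\ `|m n| <= 1 * `|ln n%:R : R|.
  by near=> n; split; near: n.
(* Beyond e the logarithm is at least 1, so constants can be absorbed into powers of l. *)
pose n0 := maxn n1 (Num.truncn (expR 1 : R)).+1.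
exists (A1 + A2), n0; split; first by rewrite addr_gt0.
move=> n; rewrite geq_max => /andP[nn1 nn2] gamma sigma rho _ /andP[sigma0 sigmaS].
move=> [lambda [f [-> hf _ hfL /andP[lambda0 lambdaS]]]] d T P X hX.
have n_gt0 : (0 < n)%N by exact: leq_trans nn2.
pose l : R := ln n%:R.
have nE : n%:R = expR l :> R by rewrite lnK// posrE ltr0n.
have l1 : 1 <= l.
  rewrite -ler_expR -nE; apply: le_trans (ltW (truncnS_gt _)) _.
  by rewrite ler_nat.
have l0 : 0 < l by rewrite (lt_le_trans _ l1).
have [m_ge m_le] := hn1 n nn1.
have [h0 h2 hb] := bandwidth_powers heta0 l1.
rewrite -/l in m_le h2 hb *.
set h := bandwidth eta n in h0 h2 hb.
have M_E : truncation eta m n = m n * (eta * l) by rewrite -h2.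
have psi_le : kappa * l / 2 + 2 * Lambda <= m n * (eta * l).
  apply: (@le_trans _ _ ((kappa / 2 + 2 * Lambda) / eta * (eta * l))); last first.
    by rewrite ler_wpM2r// mulr_ge0 ?(ltW heta0) ?(ltW l0).
  have -> : (kappa / 2 + 2 * Lambda) / eta * (eta * l) = kappa * l / 2 + 2 * Lambda * l.
    by field; rewrite gt_eqF.
  by rewrite lerD2l ler_peMr// mulr_ge0 ?(ltW hLambda).
have psi0 : 0 <= kappa * l / 2 + 2 * Lambda.
  by rewrite addr_ge0//; [rewrite divr_ge0// mulr_ge0// ltW | rewrite mulr_ge0// ltW].
have M_le : m n * (eta * l) <= eta * l ^+ 2.
  have -> : eta * l ^+ 2 = l * (eta * l) by ring.
  rewrite ler_wpM2r ?mulr_ge0 ?(ltW heta0) ?(ltW l0)//.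
  by apply: le_trans (ler_norm _) _; move: m_le; rewrite mul1r (gtr0_norm l0).
(* On |t| <= 1/h, sigma^2 t^2 <= Sigma^2 eta l = kappa l, while lambda (1 - Re phi_f) <= 2 Lambda
   because |Re phi_f| <= 1. *)
pose c := expR (- (kappa * l / 2 + 2 * Lambda)).
have phic t : `|t| <= h^-1 ->
    c <= cmod (charfun_Levy gamma sigma (fun x => lambda * f x) t) /\
    `|ln (cmod (charfun_Levy gamma sigma (fun x => lambda * f x) t))|
      <= truncation eta m n.
  move=> th; rewrite cmod_charfun_Levy_density// expRK M_E /c ler_expR.
  have t2 : t ^+ 2 <= eta * l.
    by rewrite -h2 -exprVn -real_normK ?num_real// lerXn2r ?nnegrE// invr_ge0 ltW.
  have s2 : sigma ^+ 2 <= Sigma ^+ 2 by rewrite lerXn2r ?nnegrE ?(ltW sigma0) ?(ltW hSigma).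
  have st : sigma ^+ 2 * t ^+ 2 <= kappa * l.
    by rewrite /kappa -mulrA ler_pM ?sqr_ge0.
  have st0 : 0 <= sigma ^+ 2 * t ^+ 2 by rewrite mulr_ge0 ?sqr_ge0.
  have := charfun_density_Re_bounded hf t.
  set r := charfun_density_Re f t; rewrite ler_norml => /andP[r1 r2].
  have lr : lambda * (1 - r) <= Lambda * 2.
    by apply: ler_pM => //; [exact: ltW | lra | lra].
  have lr0 : 0 <= lambda * (1 - r) by rewrite mulr_ge0 ?(ltW lambda0)// subr_ge0.
  have -> : lambda * (r - 1) = - (lambda * (1 - r)) by ring.
  split; first by lra.
  by rewrite -opprD normrN ger0_norm; lra.
have M0 : 0 <= truncation eta m n by rewrite M_E (le_trans psi0).
apply: le_trans (estimator_mse hv C0 V0 vC vV hf hfL n_gt0 (ltW lambda0) h0 M0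
  (expR_gt0 _) phic hX) _.
rewrite lee_fin [leRHS]mulrDl -/h M_E; apply: lerD.
  have -> : 2 * (lambda * (C * (h ^+ 3 * h `^ beta) * L)) ^+ 2 =
      2 * (lambda * C * L) ^+ 2 * (h ^+ 3 * h `^ beta) ^+ 2 by ring.
  rewrite hb powRM ?(ltW heta0) ?(ltW l0)// mulrA ler_wpM2r ?powR_ge0//.
  rewrite /A1 ler_wpM2r ?powR_ge0// ler_wpM2l// lerXn2r ?nnegrE//.
  - by rewrite !mulr_ge0 ?(ltW lambda0) ?(ltW C0) ?(ltW hL).
  - by rewrite !mulr_ge0 ?(ltW hLambda) ?(ltW C0) ?(ltW hL).
  - by rewrite !ler_wpM2r ?(ltW C0) ?(ltW hL).
rewrite M_E in M0; set M := m n * (eta * l) in M0 M_le *.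
have -> : 2 * ((2 + 4 * M) / c * (h ^+ 3 * V)) ^+ 2 * (2 / h) * (8 / n%:R * (2 / h)) =
    64 * (2 + 4 * M) ^+ 2 * V ^+ 2 * (h ^+ 2) ^+ 2 * (c ^- 2 / n%:R).
  by field; rewrite !gt_eqF ?expR_gt0 ?ltr0n.
(* The gain from averaging n observations beats the loss c^(-2), of order n^kappa, precisely because
   kappa < 1. *)
have -> : c ^- 2 / n%:R = expR (4 * Lambda) * expR (- ((1 - kappa) * l)).
  rewrite nE -expRN -exprVn /c -expRN opprK -expRM_natr -!expRD; congr expR.
  by field.
have -> : (h ^+ 2) ^+ 2 = eta ^- 2 * l ^- 2.
  by rewrite -[h ^+ 2]invrK h2 exprVn exprMn invfM.
have M2 : (2 + 4 * M) ^+ 2 <= (2 + 4 * eta) ^+ 2 * l ^+ 4.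
  have -> : (2 + 4 * eta) ^+ 2 * l ^+ 4 = ((2 + 4 * eta) * l ^+ 2) ^+ 2 by ring.
  have l2 : 1 <= l ^+ 2 by rewrite exprn_ege1.
  rewrite lerXn2r ?nnegrE//.
  - by rewrite addr_ge0// mulr_ge0.
  - rewrite mulr_ge0 ?exprn_ge0 ?(ltW l0)//.
    by rewrite addr_ge0// mulr_ge0// ltW.
  - rewrite [leRHS]mulrDl; apply: lerD; first by rewrite ler_peMr.
    by rewrite -mulrA ler_wpM2l.
have hBl : l ^+ 4 * expR (- ((1 - kappa) * l)) <= B * l `^ (- beta - 3).
  have -> : B * l `^ (- beta - 3) = B / l `^ (beta + 3) by rewrite -powRN (opprD beta 3).
  rewrite ler_pdivlMr ?powR_gt0//; apply: le_trans (hB l l1).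
  have -> : l `^ (beta + 7) = l ^+ 4 * l `^ (beta + 3).
    rewrite -powR_mulrn ?(ltW l0)// -powRD; last by rewrite (gt_eqF l0) implybT.
    by congr (_ `^ _); ring.
  by rewrite mulrAC.
(* The factor l^(-2) coming from h^4 is given away: the exponential decay leaves ample room. *)
have l2 : 0 <= l ^- 2 <= 1.
  by rewrite invr_ge0 exprn_ge0 ?(ltW l0)//= invf_le1 ?exprn_gt0// exprn_ege1.
have pos : 0 <= 64 * V ^+ 2 * expR (4 * Lambda) * eta ^- 2.
  by apply: ltW; rewrite !mulr_gt0 ?invr_gt0 ?exprn_gt0 ?expR_gt0.
pose E := expR (- ((1 - kappa) * l)).
apply: (@le_trans _ _ (64 * V ^+ 2 * expR (4 * Lambda) * eta ^- 2 *
    ((2 + 4 * eta) ^+ 2 * (l ^+ 4 * E)))).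
  have -> : 64 * (2 + 4 * M) ^+ 2 * V ^+ 2 * (eta ^- 2 * l ^- 2) * (expR (4 * Lambda) * E) =
    64 * V ^+ 2 * expR (4 * Lambda) * eta ^- 2 * ((2 + 4 * M) ^+ 2 * E * l ^- 2) by ring.
  rewrite ler_wpM2l//.
  have ME0 : 0 <= (2 + 4 * M) ^+ 2 * E by rewrite mulr_ge0 ?sqr_ge0 ?expR_ge0.
  case/andP: l2 => _ l2; apply: le_trans (ler_wpM2l ME0 l2) _.
  by rewrite mulr1 mulrA ler_wpM2r// expR_ge0.
have -> : A2 * l `^ (- beta - 3) = 64 * V ^+ 2 * expR (4 * Lambda) * eta ^- 2 *
    ((2 + 4 * eta) ^+ 2 * (B * l `^ (- beta - 3))) by rewrite /A2; ring.
by rewrite ler_wpM2l// ler_wpM2l ?sqr_ge0.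
Unshelve. all: by end_near. Qed.
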